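(* For every connected graph $G$ of order $n\ge 2$, $Z_g(G)\ge Z(G)$.
   Context: All graphs are finite and simple. Classical zero forcing: given a set of coloured vertices (all others white), if a coloured vertex $u$ has exactly one white neighbour $v$, then $u$ may force $v$, i.e. colour it. A zero forcing set is a set of initially coloured vertices from which repeated forcing can colour all vertices of $G$; the zero forcing number $Z(G)$ is the minimum size of a zero forcing set. The game: Let $G$ be a connected graph with at least one edge; initially all vertices are white. Alice (blue) and Bob (red) alternate turns, Alice first. On each turn the player makes exactly one move: a seed move (colour one white vertex with the player's colour) or a force move $u\to v$ (if a vertex $u$ of the player's colour has exactly one white neighbour $v$, colour $v$ with the player's colour). Being the unique white neighbour is with respect to all white vertices, irrespective of who coloured the others. If a white vertex is the target of one of the player's own legal forces, colouring it counts as a force move and not as a seed move. A move blocks a legal force $u\to v$ if that force is no longer legal after the move. Force Preservation Rule: considering the opponent's legal forces (those the opponent's coloured vertices could make) at the beginning of a turn, (i) a player may always perform one of their own legal forces, even if this blocks a force of the opponent; (ii) a seed move that blocks a legal force of the opponent is permitted only when every available seed move blocks at least one of the opponent's legal forces. The game ends when every vertex is coloured. $S_A,S_B$ denote the sets of vertices seeded by Alice and Bob. Optimal play and $Z_g$: For a position $P$ define a set $\mathcal O(P)$ of pairs. If $P$ is terminal with seed counts $(s_A,s_B)$, then $\mathcal O(P)=\{(s_A,s_B)\}$. Otherwise let $\mathcal U(P)=\bigcup_m \mathcal O(P_m)$ over all legal moves $m$, where $P_m$ is the resulting position; $\mathcal O(P)$ is the set of all pairs in $\mathcal U(P)$ with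 minimum first coordinate if Alice is to move, and with minimum second coordinate if Bob is to move. Let $\mathcal O(G)=\mathcal O(P_0(G))$ for the initial position $P_0(G)$. The game zero forcing number is $Z_g(G)=\min\{s_A+s_B:(s_A,s_B)\in\mathcal O(G)\}$. *)

(* Defs.v *)
From mathcomp Require Import all_boot.

Set Implicit Arguments.
Unset Strict Implicit.
Unset Printing Implicit Defensive.

(* A finite simple graph is a symmetric irreflexive e : rel T on a finType T. *)

Section ClassicalZeroForcing.

Variables (T : finType) (e : rel T).

Definition unique_white_nbr (W : {set T}) (u v : T) : bool :=
  [set w in W | e u w] == [set v].

Definition zf_force (B : {set T}) (u v : T) : bool :=
  (u \in B) && unique_white_nbr (~: B) u v.

Definition zf_step : rel {set T} :=
  [rel B B' | [exists u, exists v, zf_force B u v && (B' == v |: B)]].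

Definition zero_forcing_set (B : {set T}) : bool := connect zf_step B [set: T].

(* [set: T] is itself a zero forcing set, so this is the true minimum. *)
Definition zero_forcing_number : nat :=
  #|[arg min_(B < [set: T] | zero_forcing_set B) #|B| ]|.

End ClassicalZeroForcing.

Definition player := bool.
Definition Alice : player := true.
Definition Bob : player := false.
Definition opponent (p : player) : player := ~~ p.

Section Game.

Variables (T : finType) (e : rel T).

(* None is white. *)
Definition colouring := {ffun T -> option player}.

Definition white (c : colouring) : {set T} := [set v | c v == None].

Definition paint (c : colouring) (v : T) (p : player) : colouring :=
  [ffun w => if w == v then Some p else c w].

Record position := Position {
  colour : colouring;
  turn : player;
  seeds : {ffun player -> {set T}}
}.

Definition initial_position : position :=
  Position [ffun=> None] Alice [ffun=> set0].

Definition legal_force (c : colouring) (p : player) (u v : T) : bool :=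
  (c u == Some p) && unique_white_nbr e (white c) u v.

(* A target of one of the player's own legal forces cannot be seeded. *)
Definition available_seed (P : position) (v : T) : bool :=
  (v \in white (colour P)) &&
  ~~ [exists u, legal_force (colour P) (turn P) u v].

Definition blocks (P : position) (v : T) : bool :=
  [exists u, exists w,
     legal_force (colour P) (opponent (turn P)) u w &&
     ~~ legal_force (paint (colour P) v (turn P)) (opponent (turn P)) u w].

(* inl v seeds v, and inr (u, v) is the force u -> v. *)
Definition move := (T + T * T)%type.

Definition legal (P : position) (m : move) : bool :=
  match m with
  | inl v => available_seed P v &&
      (blocks P v ==> [forall w, available_seed P w ==> blocks P w])
  | inr (u, v) => legal_force (colour P) (turn P) u v
  end.

Definition play (P : position) (m : move) : position :=
  match m with
  | inl v =>
      Position (paint (colour P) v (turn P)) (opponent (turn P))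
        [ffun p => if p == turn P then v |: seeds P p else seeds P p]
  | inr (_, v) =>
      Position (paint (colour P) v (turn P)) (opponent (turn P)) (seeds P)
  end.

Definition seed_count (p : player) (s : nat * nat) : nat :=
  if p == Alice then s.1 else s.2.

Definition minimising (p : player) (U : seq (nat * nat)) : seq (nat * nat) :=
  [seq s <- U | all (fun t => seed_count p s <= seed_count p t) U].

(* Sets of pairs are represented by lists, up to order and repetition.  The   *)
(* argument n is the number of white vertices, which every legal move lowers  *)
(* by one; optimal_outcomesE is the intended recursive characterisation.      *)
Fixpoint outcomes_rec (n : nat) (P : position) : seq (nat * nat) :=
  if n is k.+1 then
    minimising (turn P)
      (flatten [seq outcomes_rec k (play P m) | m <- enum {: move} & legal P m])
  else [:: (#|seeds P Alice|, #|seeds P Bob|)].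

Definition optimal_outcomes (P : position) : seq (nat * nat) :=
  outcomes_rec #|white (colour P)| P.

Lemma white_paint c v p : white (paint c v p) = white c :\ v.
Proof. by apply/setP=> w; rewrite !inE ffunE; case: (w == v). Qed.

Lemma card_white_play P m :
  legal P m -> #|white (colour P)| = #|white (colour (play P m))|.+1.
Proof.
case: m => [v | [u v]] /=; rewrite white_paint.
  by case/andP=> /andP[vW _] _; rewrite (cardsD1 v) vW.
case/andP=> _ /eqP vE.
have: v \in [set w in white (colour P) | e u w] by rewrite vE set11.
by rewrite inE => /andP[vW _]; rewrite (cardsD1 v) vW.
Qed.

Lemma legal_move_exists P : white (colour P) != set0 -> exists m, legal P m.
Proof.
case/set0Pn=> v vW.
have [/existsP[u uv]|nforce] :=
  boolP [exists u, legal_force (colour P) (turn P) u v].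
  by exists (inr (u, v)).
have av : available_seed P v by rewrite /available_seed vW.
have [allb|] := boolP [forall w, available_seed P w ==> blocks P w].
  by exists (inl v); rewrite /= av allb implybT.
rewrite negb_forall => /existsP[w]; rewrite negb_imply => /andP[aw /negPf nb].
by exists (inl w); rewrite /= aw nb.
Qed.

Lemma optimal_outcomesE P :
  optimal_outcomes P =
    if white (colour P) == set0 then [:: (#|seeds P Alice|, #|seeds P Bob|)]
    else minimising (turn P)
      (flatten [seq optimal_outcomes (play P m)
                 | m <- enum {: move} & legal P m]).
Proof.
rewrite /optimal_outcomes -cards_eq0.
case Dn: #|white (colour P)| => [|n] //=.
congr (minimising _ (flatten _)); apply/eq_in_map => m.
rewrite mem_filter => /andP[/card_white_play + _].
by rewrite Dn => -[<-].
Qed.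

Lemma minimising_neq_nil p U : U != [::] -> minimising p U != [::].
Proof.
case: U => // s U _; rewrite -has_filter.
have exk : exists k, has (fun t => seed_count p t == k) (s :: U).
  by exists (seed_count p s); rewrite /= eqxx.
case: (ex_minnP exk) => k /hasP[t tU /eqP tk] kmin.
apply/hasP; exists t => //; apply/allP=> r rU; rewrite tk; apply: kmin.
by apply/hasP; exists r.
Qed.

Lemma optimal_outcomes_neq_nil P : optimal_outcomes P != [::].
Proof.
rewrite /optimal_outcomes; move Dn: #|white (colour P)| => n.
elim: n P Dn => [|n IHn] P Dn //=; apply: minimising_neq_nil.
have [m Lm] : exists m, legal P m.
  by apply: legal_move_exists; rewrite -card_gt0 Dn.
have: outcomes_rec n (play P m) != [::].
  by apply: IHn; move: (card_white_play Lm); rewrite Dn => -[].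
case Ds: (outcomes_rec n (play P m)) => [//|s r] _.
have: s \in flatten
    [seq outcomes_rec n (play P m) | m <- enum {: move} & legal P m].
  apply/flattenP; exists (outcomes_rec n (play P m)).
    by apply/mapP; exists m; rewrite // mem_filter Lm mem_enum.
  by rewrite Ds mem_head.
by case: (flatten _).
Qed.

Lemma game_total_exists :
  exists k, has (fun s => s.1 + s.2 == k) (optimal_outcomes initial_position).
Proof.
case: (optimal_outcomes _) (optimal_outcomes_neq_nil initial_position) => // s r.
by exists (s.1 + s.2); rewrite /= eqxx.
Qed.

Definition game_zero_forcing_number : nat := ex_minn game_total_exists.

End Game.

(* Main.v *)
Require Import Defs.
From mathcomp Require Import all_boot.

(** In any play, the vertices seeded by either player form a classical zero
    forcing set: colour them all at the start and replay the forces of the game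
    in order, skipping those whose target is already coloured.  More vertices
    are coloured than at the same stage of the game, so each remaining force is
    legal. *)

Set Implicit Arguments.
Unset Strict Implicit.
Unset Printing Implicit Defensive.

Section SeedsForce.

Variables (T : finType) (e : rel T).

Lemma zero_forcing_number_min (B : {set T}) :
  zero_forcing_set e B -> zero_forcing_number e <= #|B|.
Proof.
rewrite /zero_forcing_number; case: arg_minnP => [|A _ Amin]; last exact: Amin.
exact: connect0.
Qed.

(** Shrinking the white set can only remove rivals of [v], so a force of the game stays legal once
    more vertices are coloured, as long as its target is white. *)
Lemma unique_white_nbr_sub (W W' : {set T}) (u v : T) :
  W' \subset W -> v \in W' ->
  unique_white_nbr e W u v -> unique_white_nbr e W' u v.
Proof.
move=> /subsetP sW'W vW' /eqP/setP uv; apply/eqP/setP=> w.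
have := uv w; rewrite !inE.
case: (eqVneq w v) => [-> /andP[_ ->]|_ ]; first by rewrite vW'.
by case: (boolP (w \in W')) => // /sW'W ->.
Qed.

Definition all_seeds (P : position T) : {set T} :=
  seeds P Alice :|: seeds P Bob.

(* Quantifying over supersets X of the current seeds makes the invariant stable
   under later seed moves. *)
Definition seeds_reach (P : position T) : Prop :=
  forall X : {set T}, all_seeds P \subset X ->
  exists Y : {set T}, [/\ connect (zf_step e) X Y,
                          X \subset Y & ~: white (colour P) \subset Y].

Lemma seeds_reach_initial : seeds_reach (initial_position T).
Proof.
move=> X _; exists X; split=> //.
by apply/subsetP=> v; rewrite !inE ffunE.
Qed.

Lemma seeds_reach_play (P : position T) (m : move T) :
  legal e P m -> seeds_reach P -> seeds_reach (play P m).
Proof.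
case: m => [v _ | [u v] /= /andP[/eqP cu uv]] reachP X.
  rewrite /all_seeds /= !ffunE => sX.
  have [vX sPX] : v \in X /\ all_seeds P \subset X.
    split; last first.
      apply: subset_trans sX.
      by apply: setUSS; case: ifP => _; rewrite ?subsetU1.
    apply: (subsetP sX); rewrite inE.
    by case: (turn P); rewrite /= !inE eqxx ?orbT.
  have [Y [XY sXY cY]] := reachP X sPX.
  (* The seeded [v] lies in [X], hence already in [Y]: no further classical force is required. *)
  exists Y; split=> //.
  by rewrite white_paint setCD setUC subUset sub1set (subsetP sXY).
move=> /reachP[Y [XY sXY cY]].
have sub (Z : {set T}) : v \in Z -> Y \subset Z ->
    ~: white (paint (colour P) v (turn P)) \subset Z.
  move=> vZ sYZ; rewrite white_paint setCD setUC subUset sub1set vZ.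
  exact: subset_trans sYZ.
have [vY|vY] := boolP (v \in Y).
  by exists Y; split=> //; apply: sub.
exists (v |: Y); split.
- apply: connect_trans XY (connect1 _).
  apply/existsP; exists u; apply/existsP; exists v; rewrite eqxx andbT.
  apply/andP; split; first by apply: (subsetP cY); rewrite !inE cu.
  (* By [cY], every vertex outside [Y] is white in the game. *)
  by apply: unique_white_nbr_sub uv; rewrite ?inE // -setCS setCK.
- exact: subset_trans (subsetU1 v Y).
- by apply: sub; rewrite ?setU11 ?subsetU1.
Qed.

(** [minimising] only discards pairs, so each outcome is inherited from some successor position,
    down to the seed counts at the end of a play. *)
Lemma zero_forcing_number_le_outcome (n : nat) (P : position T) s :
  #|white (colour P)| = n -> seeds_reach P -> s \in outcomes_rec e n P ->
  zero_forcing_number e <= s.1 + s.2.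
Proof.
elim: n P => [|n IHn] P Dn reachP /=.
  rewrite inE => /eqP-> /=.
  apply: leq_trans (leq_card_setU _ _); apply: zero_forcing_number_min.
  (* Take [X] to be the seeds themselves; with no white vertex left, [Y] is the whole vertex set. *)
  have [Y [XY _]] := reachP _ (subxx _).
  by rewrite (cards0_eq Dn) setC0 subTset => /eqP YT; rewrite YT in XY.
rewrite mem_filter => /andP[_ /flattenP[U /mapP[m]]].
rewrite mem_filter => /andP[Lm _] -> sU.
apply: IHn sU; last exact: seeds_reach_play.
by apply/eqP; rewrite -eqSS -(card_white_play Lm) Dn.
Qed.

End SeedsForce.

Theorem theorem6 (T : finType) (e : rel T)
    (e_sym : symmetric e) (e_irr : irreflexive e)
    (e_conn : forall x y : T, connect e x y)
    (order_ge2 : 2 <= #|T|) :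
  zero_forcing_number e <= game_zero_forcing_number e.
Proof.
rewrite /game_zero_forcing_number; case: ex_minnP => k /hasP[s sO /eqP <-] _.
exact: zero_forcing_number_le_outcome (erefl _) (@seeds_reach_initial T e) sO.
Qed.
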